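(* Let $C\subseteq\mathbb{E}^2$ be a strictly convex domain whose boundary has exactly $m$ singular points ($m$ a nonnegative integer). Let $n\geq 2$, let $x_1,\dots,x_n\in\mathbb{E}^2$ and $\lambda_1,\dots,\lambda_n>0$, and put $T_i=x_i+C$ and $H_i=x_i+\lambda_i C$. If $T=\bigcap_{i=1}^n T_i$ is a proper intersection (so $T$ is a translative $C$-polygon), then $$n\leq |\mathrm{Vert}(T)|\leq n+m,$$ and if $H=\bigcap_{i=1}^n H_i$ is a proper intersection (so $H$ is a $C$-polygon), then $$n\leq |\mathrm{Vert}(H)|\leq 2(n-1)+m.$$
   Context: A convex domain is a compact convex subset of $\mathbb{E}^2$ with non-empty interior; it is strictly convex if the relative interior of the segment joining any two of its boundary points lies in its interior. A boundary point $x$ of a convex domain $K$ is singular if $K$ has more than one supporting line at $x$. An intersection $\bigcap_{i=1}^n X_i$ is reduced if $\bigcap_{i=1}^n X_i\subsetneq\bigcap_{i\neq j}X_i$ for every $j$, and proper if it is reduced and has non-empty interior. For a convex domain $K$, $\mathrm{Vert}(K)$ denotes the set of singular boundary points of $K$ (its vertices). *)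

(* Defs.v *)
From mathcomp Require Import all_boot all_order all_algebra.
From mathcomp Require Import all_classical all_reals all_analysis.

Set Implicit Arguments.
Unset Strict Implicit.
Unset Printing Implicit Defensive.

Import Order.TTheory GRing.Theory Num.Theory.
Import numFieldNormedType.Exports.

Local Open Scope classical_set_scope.
Local Open Scope ring_scope.

(* The Euclidean plane is modelled by row vectors; the library norm on them is
   the sup norm, which induces the Euclidean topology. *)
Notation plane R := 'rV[R]_2.

Definition dot (R : realType) (u v : plane R) : R := (u *m v^T) 0 0.

Definition boundary (T : topologicalType) (A : set T) : set T :=
  closure A `\` interior A.

Definition open_segment (R : realType) (x y : plane R) : set (plane R) :=
  [set (1 - t) *: x + t *: y | t in [set t : R | 0 < t < 1]].

Definition convex_domain (R : realType) (K : set (plane R)) : Prop :=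
  [/\ compact K, convex_set K & interior K !=set0].

(* The two boundary points are taken distinct: the relative interior of a
   degenerate segment would be the boundary point itself. *)
Definition strictly_convex_domain (R : realType) (K : set (plane R)) : Prop :=
  convex_domain K /\
  forall x y, boundary K x -> boundary K y -> x != y ->
    open_segment x y `<=` interior K.

(* One inequality suffices for "K lies on one side of L", since the pair (a, c)
   may be replaced by (- a, - c). *)
Definition supporting_line (R : realType) (K : set (plane R)) (x : plane R)
    (L : set (plane R)) : Prop :=
  exists (a : plane R) (c : R),
    [/\ a != 0, L = [set y | dot a y = c], L x
      & K `<=` [set y | dot a y <= c]].

Definition singular_point (R : realType) (K : set (plane R)) (x : plane R)
    : Prop :=
  boundary K x /\
  exists L1 L2, [/\ supporting_line K x L1, supporting_line K x L2 & L1 <> L2].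

Definition Vert (R : realType) (K : set (plane R)) : set (plane R) :=
  [set x | singular_point K x].

Definition translate (R : realType) (x : plane R) (C : set (plane R))
    : set (plane R) :=
  [set x + y | y in C].

Definition homothet (R : realType) (x : plane R) (lambda : R)
    (C : set (plane R)) : set (plane R) :=
  [set x + lambda *: y | y in C].

Definition reduced_intersection (T : Type) (n : nat) (X : 'I_n -> set T)
    : Prop :=
  forall j, \bigcap_i X i `<` \bigcap_(i in [set i | i != j]) X i.

Definition proper_intersection (T : topologicalType) (n : nat)
    (X : 'I_n -> set T) : Prop :=
  reduced_intersection X /\ interior (\bigcap_i X i) !=set0.

(* Main.v *)
Require Import Defs.
From mathcomp Require Import all_boot all_order all_algebra.
From mathcomp Require Import all_classical all_reals all_analysis.
From mathcomp Require Import zify ring lra.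

Import Order.TTheory GRing.Theory Num.Theory.
Import numFieldNormedType.Exports.

Local Open Scope classical_set_scope.
Local Open Scope ring_scope.
Local Open Scope card_scope.

(* Call a point of the intersection a junction if it lies on the boundary of two
   of the homothets H_i. At a vertex that is not a junction a single H_i is
   active, so the vertex is the image of a vertex c of C; two independent normals
   at c show that c has only one such image, which gives the summand m. A junction
   is a vertex, for otherwise the two active homothets share their normal, hence
   by strict convexity are homothetic from that point, and one contains the other.

   Upper bounds: a largest H_j carries at most two junctions. Given three, expand
   the other homothet active at each of them onto H_j. In barycentric coordinates
   with respect to the three points, each expansion translates away from exactly
   one of them and sends that one inside H_j; and all three expansions single out
   the same point, which contradicts that the k-th one keeps the k-th point on the
   boundary. Hence at most n junctions for translates, by double counting, and at
   most 2(n-1) for homothets, by removing the largest one.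

   Lower bound: seen from an interior point, the directions in which H_i alone is
   the first to be left form disjoint nonempty open subsets U_i of the circle, and
   every direction outside their union points at a junction. The first exits from
   the U_i, turning in one sense, are n distinct directions. *)

(** * Affine geometry of expansions of a strictly convex set *)

Section StrictConvexity.
Context {R : realType}.
Implicit Types (K Ki : set (plane R)) (p q u v w : plane R).

(** [Ki] stands for the interior of [K]; relying on these two properties alone keeps the barycentric
    arguments free of topology. *)
Definition strictly_convex_with K Ki := Ki `<=` K /\
  forall u v (t : R), K u -> K v -> u <> v -> 0 < t < 1 ->
    Ki ((1 - t) *: u + t *: v).

Lemma strictly_convex_mix K Ki u v (t : R) : strictly_convex_with K Ki ->
  Ki u -> K v -> 0 <= t < 1 -> Ki ((1 - t) *: u + t *: v).
Proof.
move=> [KiK sc] Kiu Kv /andP[]; rewrite le_eqVlt => /predU1P[<- _|t0 t1].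
  by rewrite subr0 scale1r scale0r addr0.
have [->|/eqP uv] := eqVneq v u; last by apply: sc => //; [exact: KiK|exact/nesym|rewrite t0].
by rewrite -scalerDl subrK scale1r.
Qed.

Lemma strictly_convex_convex K Ki u v (t : R) : strictly_convex_with K Ki ->
  K u -> K v -> 0 <= t <= 1 -> K ((1 - t) *: u + t *: v).
Proof.
move=> [KiK sc] Ku Kv /andP[].
rewrite le_eqVlt => /predU1P[<- _|t0]; first by rewrite subr0 scale1r scale0r addr0.
rewrite le_eqVlt => /predU1P[->|t1]; first by rewrite subrr scale1r scale0r add0r.
have [->|/eqP uv] := eqVneq v u; first by rewrite -scalerDl subrK scale1r.
by apply/KiK/sc => //; [exact/nesym|rewrite t0].
Qed.

(* A boundary point of K is extreme, so it is the only point of K in the cone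
   opposite to the triangle p1 p2 p3 at p1. *)
Lemma opposite_cone K Ki p1 p2 p3 (a1 a2 a3 : R) : strictly_convex_with K Ki ->
  K p1 -> K p2 -> K p3 -> p1 <> p2 -> p1 <> p3 -> p2 <> p3 -> ~ Ki p1 ->
  K (a1 *: p1 + a2 *: p2 + a3 *: p3) -> a1 + a2 + a3 = 1 ->
  a2 <= 0 -> a3 <= 0 -> a2 = 0 /\ a3 = 0.
Proof.
move=> sc K1 K2 K3 n12 n13 n23 nKi1 Kq sum a20 a30.
have [b0|b0] := eqVneq (a2 + a3) 0; first by split; lra.
have {}b0 : a2 + a3 < 0 by rewrite lt_neqAle b0 /=; lra.
exfalso; set q := _ + a3 *: p3 in Kq.
(* Solving for [p1] puts it strictly between [q] and the point [r] of the segment from [p2] to [p3],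
   hence in [Ki] unless [q = r]; in that case [p1] is [r] itself. *)
pose s := a3 / (a2 + a3).
have bne : a2 + a3 != 0 by rewrite lt_eqF.
have s0 : 0 <= s by rewrite /s mulr_le0 ?invr_le0//; lra.
have s1 : s <= 1 by rewrite /s ler_ndivrMr//; lra.
pose r := (1 - s) *: p2 + s *: p3.
have Kr : K r by apply: strictly_convex_convex sc _ _ _; rewrite ?s0.
have p1E : p1 = (1 - (- (a2 + a3) / a1)) *: q + (- (a2 + a3) / a1) *: r.
  have a1E : a1 = 1 - a2 - a3 by lra.
  have a1n : 1 - a2 - a3 != 0 by rewrite gt_eqF//; lra.
  rewrite /q /r /s a1E; apply/rowP => k; rewrite !mxE; field; exact/andP.
have [qr|/eqP qr] := eqVneq q r; last first.
  apply: nKi1; rewrite p1E; apply: sc.2 => //.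
  have a1p : 0 < a1 by lra.
  by rewrite divr_gt0//=; [rewrite ltr_pdivrMr//; lra|lra].
have {}p1E : p1 = r by rewrite p1E qr -scalerDl subrK scale1r.
have [s0E|sn0] := eqVneq s 0.
  by apply: n12; rewrite p1E /r s0E subr0 scale1r scale0r addr0.
have [s1E|sn1] := eqVneq s 1.
  by apply: n13; rewrite p1E /r s1E subrr scale1r scale0r add0r.
apply: nKi1; rewrite p1E; apply: sc.2 => //.
by rewrite !lt_neqAle eq_sym sn0 s0 sn1.
Qed.

Definition cross u v : R := u 0 0 * v 0 1 - u 0 1 * v 0 0.

Lemma plane_eq u v : u 0 0 = v 0 0 -> u 0 1 = v 0 1 -> u = v.
Proof.
move=> h0 h1; apply/rowP => k.
have [->|->] : k = 0 \/ k = 1; [|exact: h0|exact: h1].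
by case: k => -[|[|//]] i; [left|right]; exact/val_inj.
Qed.

Lemma cross_eq0 u v : u <> 0 -> cross u v = 0 -> exists c, v = c *: u.
Proof.
rewrite /cross => u0 uv0.
have [u00|u00] := eqVneq (u 0 0) 0.
  have u01 : u 0 1 != 0.
    by apply/eqP => u01; apply: u0; apply: plane_eq; rewrite ?u00 ?u01 mxE.
  exists (v 0 1 / u 0 1); apply: plane_eq; rewrite !mxE.
    by apply: (mulfI u01); move: uv0; rewrite u00; lra.
  by field.
exists (v 0 0 / u 0 0); apply: plane_eq; rewrite !mxE; first by field.
by apply: (mulfI u00); rewrite mulrA mulrCA divff// mulr1; lra.
Qed.

Lemma cross_basis u v w : cross u v != 0 -> exists a b, w = a *: u + b *: v.
Proof.
move=> D; exists (cross w v / cross u v), (cross u w / cross u v).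
by apply: plane_eq; rewrite !mxE; move: D; rewrite /cross => D; field.
Qed.

(** The middle one of three distinct collinear points would lie in [Ki]; the position [c] of [p3] on
    the line, with [p1] at 0 and [p2] at 1, tells which one that is. *)
Lemma boundary_noncollinear K Ki p1 p2 p3 : strictly_convex_with K Ki ->
  K p1 -> K p2 -> K p3 -> p1 <> p2 -> p1 <> p3 -> p2 <> p3 ->
  ~ Ki p1 -> ~ Ki p2 -> ~ Ki p3 -> cross (p2 - p1) (p3 - p1) != 0.
Proof.
move=> sc K1 K2 K3 n12 n13 n23 nKi1 nKi2 nKi3; apply/eqP => D.
have p21 : p2 - p1 <> 0 by move/eqP; rewrite subr_eq0 => /eqP/esym.
have [c p3E] := cross_eq0 _ _ p21 D.
have {p3E}p3E : p3 = (1 - c) *: p1 + c *: p2.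
  by rewrite -(subrK p1 p3) p3E; apply/rowP => k; rewrite !mxE; ring.
have c0 : c != 0.
  by apply/eqP => c0; apply: n13; rewrite p3E c0 subr0 scale1r scale0r addr0.
have c1 : c != 1.
  by apply/eqP => c1; apply: n23; rewrite p3E c1 subrr scale1r scale0r add0r.
have [clt1|] := ltP c 1; last first.
  rewrite le_eqVlt eq_sym (negbTE c1) /= => cgt1.
  apply: nKi2; have -> : p2 = (1 - c^-1) *: p1 + c^-1 *: p3.
    by rewrite p3E; apply/rowP => k; rewrite !mxE; field.
  by apply: sc.2 => //; rewrite invr_gt0 invf_lt1; lra.
have [cgt0|] := ltP 0 c.
  by apply: nKi3; rewrite p3E; apply: sc.2; rewrite ?cgt0.
rewrite le_eqVlt (negbTE c0) /= => clt0.
have d0 : 1 - c != 0 by rewrite gt_eqF//; lra.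
apply: nKi1; have -> : p1 = (1 - (1 - c)^-1) *: p2 + (1 - c)^-1 *: p3.
  by rewrite p3E; apply/rowP => k; rewrite !mxE; field.
by apply: sc.2 => //; rewrite invr_gt0 invf_lt1; lra.
Qed.

(* Barycentric sign pattern of the translation part of z |-> mu z + tau. *)
Definition leans_off p1 p2 p3 (mu : R) (tau : plane R) :=
  exists t1 t2 t3, [/\ tau = t1 *: p1 + t2 *: p2 + t3 *: p3,
    t1 + t2 + t3 = 1 - mu, 0 < t1, 0 < t2 & t3 <= 0].

Lemma leans_offC p1 p2 p3 mu tau :
  leans_off p1 p2 p3 mu tau -> leans_off p2 p1 p3 mu tau.
Proof.
move=> [t1 [t2 [t3 [-> s t10 t20 t30]]]]; exists t2, t1, t3.
by split => //; [rewrite (addrC (t1 *: p1))|lra].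
Qed.

(** Let [m] divide the segment from [p1] to [p2] in the ratio of [t2] to [t1]. Then [tau] is a
    combination of [m] and [p3], so [m], [p3] and their images are collinear. The image of [p3] lies
    between [p3] and [m], or else between [m] and the image of [m]; and [m] is in [Ki]. *)
Lemma leans_off_interior K Ki p1 p2 p3 mu tau : strictly_convex_with K Ki ->
  K p1 -> K p2 -> K p3 -> p1 <> p2 ->
  K (mu *: p1 + tau) -> K (mu *: p2 + tau) ->
  leans_off p1 p2 p3 mu tau -> 1 <= mu -> Ki (mu *: p3 + tau).
Proof.
move=> sc K1 K2 K3 n12 Kq1 Kq2 [t1 [t2 [t3 [tauE s t10 t20 t30]]]] mu1.
pose c := t2 / (t1 + t2).
have t12 : t1 + t2 != 0 by rewrite gt_eqF//; lra.
have c01 : 0 < c < 1.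
  by rewrite /c divr_gt0//= ?ltr_pdivrMr; lra.
have Kim : Ki ((1 - c) *: p1 + c *: p2) by apply: sc.2.
have Km' : K ((1 - c) *: (mu *: p1 + tau) + c *: (mu *: p2 + tau)).
  by apply: strictly_convex_convex sc _ _ _ => //; move: c01; lra.
have t3E : t3 = 1 - mu - t1 - t2 by lra.
have [s0|s0] := leP 0 (t3 + mu).
  rewrite (_ : _ + tau =
    (1 - (t3 + mu)) *: ((1 - c) *: p1 + c *: p2) + (t3 + mu) *: p3).
    by apply: strictly_convex_mix sc _ _ _ => //; lra.
  by rewrite tauE t3E; apply/rowP => k; rewrite !mxE /c; field.
have t3n : t3 != 0 by rewrite lt_eqF//; lra.
rewrite (_ : _ + tau = (1 - (t3 + mu) / t3) *: ((1 - c) *: p1 + c *: p2) +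
  ((t3 + mu) / t3) *:
    ((1 - c) *: (mu *: p1 + tau) + c *: (mu *: p2 + tau))).
  apply: strictly_convex_mix sc _ _ _ => //.
  have t3lt0 : t3 < 0 by lra.
  by rewrite ltr_ndivrMr// mulr_le0 ?invr_le0; lra.
rewrite tauE; apply/rowP => k; rewrite !mxE /c t3E; field.
by rewrite t12 -t3E t3n.
Qed.

(** The two images of [p1] lie on opposite sides of the line through [p1] and [p3]. The segment
    joining them meets this line at a point whose [p3]-coordinate is negative because [1 <= mu] and
    [1 <= nu]; [opposite_cone] forbids this. *)
Lemma leans_off_unique K Ki p1 p2 p3 mu tau nu sigma :
  strictly_convex_with K Ki ->
  K p1 -> K p2 -> K p3 -> p1 <> p2 -> p1 <> p3 -> p2 <> p3 -> ~ Ki p1 ->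
  K (mu *: p1 + tau) -> K (nu *: p1 + sigma) -> 1 <= mu -> 1 <= nu ->
  leans_off p1 p2 p3 mu tau -> leans_off p1 p3 p2 nu sigma -> False.
Proof.
move=> sc K1 K2 K3 n12 n13 n23 nKi1 Kq Kr mu1 nu1.
move=> [t1 [t2 [t3 [tauE st t10 t20 t30]]]].
move=> [s1 [s3 [s2 [sigmaE ss s10 s30 s20]]]].
pose d := t2 - s2; have d0 : 0 < d by rewrite /d; lra.
have dn0 : d != 0 by rewrite gt_eqF.
(* This weight cancels the [p2]-coordinate. *)
pose c := t2 / d.
have c01 : 0 <= c <= 1.
  by rewrite /c divr_ge0/= ?ler_pdivrMr// ?ltW// /d; lra.
have := strictly_convex_convex _ _ _ _ c sc Kq Kr c01.
rewrite (_ : _ + _ = ((1 - c) * (mu + t1) + c * (nu + s1)) *: p1 +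
  0 *: p2 + ((1 - c) * t3 + c * s3) *: p3); last first.
  by rewrite tauE sigmaE; apply/rowP => k; rewrite !mxE /c /d; field; exact: dn0.
have c3E : (1 - c) * t3 + c * s3 = (t2 * s3 - s2 * t3) / d.
  by rewrite /c /d; field; exact: dn0.
have c3 : (1 - c) * t3 + c * s3 < 0.
  by rewrite c3E pmulr_llt0 ?invr_gt0//; nra.
have sE : (1 - c) * (mu + t1) + c * (nu + s1) + 0 + ((1 - c) * t3 + c * s3) = 1.
  have -> : t1 = 1 - mu - t2 - t3 by lra.
  have -> : s1 = 1 - nu - s2 - s3 by lra.
  by rewrite /c /d; field; exact: dn0.
move=> Kx.
have [//||_ c30] :=
  opposite_cone _ _ _ _ _ _ _ _ sc K1 K2 K3 n12 n13 n23 nKi1 Kx sE.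
  exact: ltW.
by move: c3; rewrite c30 ltxx.
Qed.

(** The coordinates of [tau] sum to [1 - mu <= 0], so they are not all positive. If two are
    nonpositive, [opposite_cone] makes both zero; the third is then [1 - mu], hence nonpositive as
    well, and the map is the identity. *)
Lemma leans_off_some K Ki p1 p2 p3 mu tau : strictly_convex_with K Ki ->
  K p1 -> K p2 -> K p3 -> p1 <> p2 -> p1 <> p3 -> p2 <> p3 ->
  ~ Ki p1 -> ~ Ki p2 -> ~ Ki p3 -> 1 <= mu -> ~ (mu = 1 /\ tau = 0) ->
  K (mu *: p1 + tau) -> K (mu *: p2 + tau) -> K (mu *: p3 + tau) ->
  [\/ leans_off p2 p3 p1 mu tau, leans_off p1 p3 p2 mu tau
    | leans_off p1 p2 p3 mu tau].
Proof.
move=> sc K1 K2 K3 n12 n13 n23 nKi1 nKi2 nKi3 mu1 nid Kq1 Kq2 Kq3.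
have D := boundary_noncollinear _ _ _ _ _ sc K1 K2 K3 n12 n13 n23 nKi1 nKi2 nKi3.
have [t2 [t3 E]] := cross_basis _ _ (tau - (1 - mu) *: p1) D.
pose t1 : R := 1 - mu - t2 - t3.
have tauE : tau = t1 *: p1 + t2 *: p2 + t3 *: p3.
  rewrite -(subrK ((1 - mu) *: p1) tau) E.
  by apply/rowP => k; rewrite !mxE /t1; ring.
have s : t1 + t2 + t3 = 1 - mu by rewrite /t1; ring.
clearbody t1; clear E D.
have o1 : t2 <= 0 -> t3 <= 0 -> t2 = 0 /\ t3 = 0.
  apply: (opposite_cone K Ki p1 p2 p3 (mu + t1)) => //; last by lra.
  by move: Kq1; congr K; rewrite tauE; apply/rowP => k; rewrite !mxE; ring.
have o2 : t1 <= 0 -> t3 <= 0 -> t1 = 0 /\ t3 = 0.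
  apply: (opposite_cone K Ki p2 p1 p3 (mu + t2)) => //; [exact/nesym| |lra].
  by move: Kq2; congr K; rewrite tauE; apply/rowP => k; rewrite !mxE; ring.
have o3 : t1 <= 0 -> t2 <= 0 -> t1 = 0 /\ t2 = 0.
  apply: (opposite_cone K Ki p3 p1 p2 (mu + t3)) => //; [exact/nesym|exact/nesym| |lra].
  by move: Kq3; congr K; rewrite tauE; apply/rowP => k; rewrite !mxE; ring.
have [t10|t10] := leP t1 0; have [t20|t20] := leP t2 0;
  have [t30|t30] := leP t3 0.
- exfalso; apply: nid; have [h1 h2] := o3 t10 t20; have [_ h3] := o1 t20 t30.
  split; first by lra.
  by rewrite tauE h1 h2 h3 !scale0r !addr0.
- by have := o3 t10 t20; lra.
- by have := o2 t10 t30; lra.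
- apply: Or31; exists t2, t3, t1; split => //; last by lra.
  by rewrite tauE; apply/rowP => k; rewrite !mxE; ring.
- by have := o1 t20 t30; lra.
- apply: Or32; exists t1, t3, t2; split => //; last by lra.
  by rewrite tauE; apply/rowP => k; rewrite !mxE; ring.
- by apply: Or33; exists t1, t2, t3.
- by have := addr_gt0 (addr_gt0 t10 t20) t30; rewrite s subr_gt0 ltNge mu1.
Qed.

(* The k-th map expands onto K another homothet that is active at p k. *)
Lemma no_three_contacts K Ki (p : 'I_3 -> plane R) (mu : 'I_3 -> R)
    (tau : 'I_3 -> plane R) : strictly_convex_with K Ki -> injective p ->
  (forall k, K (p k)) -> (forall k, ~ Ki (p k)) -> (forall k, 1 <= mu k) ->
  (forall k, ~ (mu k = 1 /\ tau k = 0)) ->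
  (forall k l, K (mu k *: p l + tau k)) ->
  (forall k, ~ Ki (mu k *: p k + tau k)) -> False.
Proof.
move=> sc pI Kp nKip mu1 nid Kq nKiq.
pose i0 : 'I_3 := 0; pose i1 : 'I_3 := 1; pose i2 : 'I_3 := 2%:R.
have n01 : p i0 <> p i1 by move/pI.
have n02 : p i0 <> p i2 by move/pI.
have n12 : p i1 <> p i2 by move/pI.
have n10 := nesym n01; have n20 := nesym n02; have n21 := nesym n12.
have some k := leans_off_some _ _ _ _ _ _ _ sc (Kp i0) (Kp i1) (Kp i2) n01 n02 n12
  (nKip _) (nKip _) (nKip _) (mu1 k) (nid k) (Kq k _) (Kq k _) (Kq k _).
have int := leans_off_interior _ _ _ _ _ _ _ sc.
have uniq k l := leans_off_unique _ _ _ _ _ (mu k) (tau k) (mu l) (tau l) sc.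
(* If map 0 leans off a point [l] other than 0, only map [l] needs inspection: it leans off its own
   point or disagrees with map 0. *)
case: (some i0) => h0.
- by apply: (nKiq i0); apply: int h0 _.
- case: (some i1) => h1.
  + by apply: (uniq (p i2) (p i0) (p i1) i0 i1) => //; exact: leans_offC.
  + by apply: (nKiq i1); apply: int h1 _.
  + by apply: (uniq (p i0) (p i1) (p i2) i1 i0).
- case: (some i2) => h2.
  + by apply: (uniq (p i1) (p i0) (p i2) i0 i2) => //; exact: leans_offC.
  + by apply: (uniq (p i0) (p i1) (p i2) i0 i2).
  + by apply: (nKiq i2); apply: int h2 _.
Qed.

End StrictConvexity.

(** * Topology and strict convexity of homothets *)

Section Homothets.
Context {R : realType}.
Implicit Types (C K : set (plane R)) (p q x u v z : plane R) (l : R).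

Lemma affine_continuous l x v : continuous (fun z : plane R => l *: (z - x) + v).
Proof.
have F (z : plane R) : Filter (nbhs z) by exact: nbhs_filter.
move=> z; have Fz := F z.
apply: (@cvgD _ _ _ _ Fz (fun z => l *: (z - x)) (fun=> v)); last exact: cvg_cst.
apply: (@cvgZ _ _ _ _ Fz (fun=> l) (fun z => z - x)); first exact: cvg_cst.
by apply: (@cvgB _ _ _ _ Fz id (fun=> x)); [exact: cvg_id|exact: cvg_cst].
Qed.

Lemma homothetP l x C z : 0 < l -> homothet x l C z <-> C (l^-1 *: (z - x)).
Proof.
move=> l0; have ln0 : l != 0 by rewrite gt_eqF.
split=> [[y Cy <-]|Cy]; first by rewrite addrAC subrr add0r scalerK.
by exists (l^-1 *: (z - x)) => //=; rewrite scalerKV// addrC subrK.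
Qed.

Lemma homothet_interiorP l x C z : 0 < l ->
  interior (homothet x l C) z <-> interior C (l^-1 *: (z - x)).
Proof.
move=> l0; have ln0 : l != 0 by rewrite gt_eqF.
split=> [iz|].
- have o : open ((fun y => l *: (y - 0) + x) @^-1` interior (homothet x l C)).
    by apply: open_comp; [move=> y _; exact: affine_continuous|exact: open_interior].
  have : (fun y => l *: (y - 0) + x) @^-1` interior (homothet x l C) `<=` C.
    move=> y /interior_subset /(homothetP _ _ _ _ l0).
    by rewrite subr0 addrK scalerK.
  by rewrite open_subsetE//; apply; rewrite /= subr0 scalerKV// subrK.
- have o : open ((fun y => l^-1 *: (y - x) + 0) @^-1` interior C).
    by apply: open_comp; [move=> y _; exact: affine_continuous|exact: open_interior].
  have : (fun y => l^-1 *: (y - x) + 0) @^-1` interior C `<=` homothet x l C.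
    move=> y /interior_subset; rewrite addr0 => Cy; exact/homothetP.
  by rewrite open_subsetE// => h iz; apply: h; rewrite /= addr0.
Qed.

Lemma homothet_closed l x C : 0 < l -> closed C -> closed (homothet x l C).
Proof.
move=> l0 cC; rewrite (_ : homothet x l C = (fun y => l^-1 *: (y - x) + 0) @^-1` C).
  by apply: preimage_closed => // y _; exact: affine_continuous.
by apply/seteqP; split=> y /=; rewrite addr0 => /(homothetP _ _ _ _ l0).
Qed.

Lemma homothet_strictly_convex l x C : 0 < l ->
  strictly_convex_with C (interior C) ->
  strictly_convex_with (homothet x l C) (interior (homothet x l C)).
Proof.
move=> l0 [_ sc]; split=> [|u v t Hu Hv uv t01]; first exact: interior_subset.
apply/homothet_interiorP => //.
have -> : l^-1 *: ((1 - t) *: u + t *: v - x) =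
    (1 - t) *: (l^-1 *: (u - x)) + t *: (l^-1 *: (v - x)).
  by apply/rowP => k; rewrite !mxE; ring.
apply: sc => //; [exact/homothetP|exact/homothetP|].
move=> /(scalerI _) h; apply: uv; apply: (addIr (- x)); apply: h.
by rewrite invr_eq0 gt_eqF.
Qed.

(** [f] inverts the homothety with centre [v] and ratio [1 - t], so the preimage of the interior
    under [f] is an open subset of [K]. *)
Lemma convex_interior_mix K u v (t : R) :
  (forall u v (t : R), K u -> K v -> 0 < t < 1 -> K ((1 - t) *: u + t *: v)) ->
  interior K u -> K v -> 0 < t < 1 -> interior K ((1 - t) *: u + t *: v).
Proof.
move=> cK Ku Kv t01; have t1 : 1 - t != 0 by rewrite gt_eqF//; lra.
pose f z := (1 - t)^-1 *: (z - t *: v) + 0.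
have o : open (f @^-1` interior K).
  by apply: open_comp; [move=> y _; exact: affine_continuous|exact: open_interior].
have : f @^-1` interior K `<=` K.
  move=> y /interior_subset Kfy.
  have -> : y = (1 - t) *: f y + t *: v by rewrite /f addr0 scalerKV// subrK.
  exact: cK.
by rewrite open_subsetE//; apply; rewrite /f /= addrK scalerK// addr0.
Qed.

(** The definition constrains only pairs of boundary points; pairs with an interior point are
    covered by [convex_interior_mix]. *)
Lemma strictly_convex_domainW C : strictly_convex_domain C ->
  [/\ compact C, closed C, interior C !=set0
    & strictly_convex_with C (interior C)].
Proof.
move=> [[cC convC iC] sc]; have clC := compact_closed (@norm_hausdorff _ _) cC.
split=> //; split=> [|u v t Cu Cv uv t01]; first exact: interior_subset.
have conv u' v' (s : R) : C u' -> C v' -> 0 < s < 1 -> C ((1 - s) *: u' + s *: v').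
  move=> Cu' Cv' /andP[/ltW s0 /ltW s1].
  have := convC _ _ (Itv01 s0 s1) (mem_set Cv') (mem_set Cu'); rewrite inE.
  by rewrite addrC.
have bd w : C w -> ~ interior C w -> boundary C w.
  by move=> Cw nw; split => //; exact: subset_closure.
have [iu|nu] := pselect (interior C u); first exact: convex_interior_mix.
have [iv|nv] := pselect (interior C v).
  rewrite addrC -{1}(subKr 1 t); apply: convex_interior_mix => //; lra.
by apply: (sc u v); [exact: bd|exact: bd|exact/eqP|exists t].
Qed.

Lemma translateE x C : translate x C = homothet x 1 C.
Proof. by apply: eq_imagel => y _; rewrite scale1r. Qed.

End Homothets.

(** * Outer normals and supporting lines *)

Section Support.
Context {R : realType}.
Implicit Types (C K : set (plane R)) (a b p u v z : plane R).

Lemma dotE a u : dot a u = a 0 0 * u 0 0 + a 0 1 * u 0 1.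
Proof.
rewrite /dot mxE !big_ord_recl big_ord0 addr0 !mxE.
by rewrite (_ : lift ord0 ord0 = 1)//; exact/val_inj.
Qed.

Lemma dotDr a u v : dot a (u + v) = dot a u + dot a v.
Proof. by rewrite !dotE !mxE; ring. Qed.

Lemma dotZr a u (t : R) : dot a (t *: u) = t * dot a u.
Proof. by rewrite !dotE !mxE; ring. Qed.

Lemma dotDl a b u : dot (a + b) u = dot a u + dot b u.
Proof. by rewrite !dotE !mxE; ring. Qed.

Lemma dotZl a u (t : R) : dot (t *: a) u = t * dot a u.
Proof. by rewrite !dotE !mxE; ring. Qed.

Lemma dotBr a u v : dot a (u - v) = dot a u - dot a v.
Proof. by rewrite !dotE !mxE; ring. Qed.

Lemma dot_gt0 a : a <> 0 -> 0 < dot a a.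
Proof.
move=> a0; rewrite lt_neqAle eq_sym dotE -!expr2 addr_ge0 ?sqr_ge0// andbT.
apply/negP; rewrite paddr_eq0 ?sqr_ge0// !sqrf_eq0 => /andP[/eqP h0 /eqP h1].
by apply: a0; apply: plane_eq; rewrite ?h0 ?h1 mxE.
Qed.

Lemma cross_neq0l a b : cross a b != 0 -> a <> 0.
Proof. by move=> + a0; rewrite a0 /cross !mxE !mul0r subrr eqxx. Qed.

Lemma dot_basis_eq a b u v : cross a b != 0 ->
  dot a u = dot a v -> dot b u = dot b v -> u = v.
Proof.
move=> D ha hb; apply: plane_eq; apply: (mulfI D).
  have E (w : plane R) : cross a b * w 0 0 = b 0 1 * dot a w - a 0 1 * dot b w.
    by rewrite !dotE /cross; ring.
  by rewrite !E ha hb.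
have E (w : plane R) : cross a b * w 0 1 = a 0 0 * dot b w - b 0 0 * dot a w.
  by rewrite !dotE /cross; ring.
by rewrite !E ha hb.
Qed.

Lemma interior_ray K z v : interior K z ->
  exists2 e : R, 0 < e & forall t : R, 0 <= t <= e -> interior K (z + t *: v).
Proof.
move=> Kz; have : \forall t \near (0 : R), interior K (z + t *: v).
  have h : (fun t : R => z + t *: v) @ (0 : R) --> z + (0 : R) *: v.
    by apply: cvgD; [exact: cvg_cst|apply: cvgZr_tmp; exact: cvg_id].
  by rewrite scale0r addr0 in h; apply: h; exact: nbhs_interior.
move=> /nbhs_ballP[e /= e0 he]; exists (e / 2) => [|t t0].
  by rewrite divr_gt0.
by apply: he; rewrite /ball /= sub0r normrN ger0_norm; lra.
Qed.

Lemma interior_not_max K z a : a <> 0 -> interior K z ->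
  exists2 y, K y & dot a z < dot a y.
Proof.
move=> a0 /(interior_ray _ _ a)[e e0 he]; exists (z + e *: a).
  by apply: interior_subset; apply: he; rewrite (ltW e0) lexx.
by rewrite dotDr dotZr ltrDl mulr_gt0// dot_gt0.
Qed.

Definition supports K p a := forall y, K y -> dot a y <= dot a p.

(* Look for a = e + s f with e = p - q, q interior and f orthogonal to e: the
   points of K on one side of the line p q bound s from below, those on the other
   side from above, and the supremum of the lower bounds satisfies both. *)
Lemma supports_exists K p : strictly_convex_with K (interior K) ->
  interior K !=set0 -> K p -> ~ interior K p ->
  exists2 a, a <> 0 & supports K p a.
Proof.
move=> sc [q Kq] Kp nKp; pose e := p - q.
have e0 : e <> 0 by rewrite /e => /eqP; rewrite subr_eq0 => /eqP po; rewrite po in nKp.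
pose N := dot e e; have N0 : 0 < N by exact: dot_gt0.
(* Coordinates along and across the axis from [q] to [p], scaled so that [p] has coordinates [N] and
   0. *)
pose X y := dot e (y - q); pose Y y := cross e (y - q).
pose f : plane R := \row_k (if k == 0 then - e 0 1 else e 0 0).
have f0 : f 0 0 = - e 0 1 by rewrite mxE.
have f1 : f 0 1 = e 0 0 by rewrite mxE.
have fe : dot f e = 0 by rewrite dotE f0 f1; ring.
have YE y : Y y = dot f (y - q) by rewrite /Y /cross dotE f0 f1; ring.
have XD u v (t : R) : X ((1 - t) *: u + t *: v) = (1 - t) * X u + t * X v.
  by rewrite /X !dotBr dotDr !dotZr; ring.
have YD u v (t : R) : Y ((1 - t) *: u + t *: v) = (1 - t) * Y u + t * Y v.
  by rewrite !YE !dotBr dotDr !dotZr; ring.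
have Xq : X q = 0 by rewrite /X subrr dotE !mxE !mulr0 addr0.
have Yq : Y q = 0 by rewrite YE subrr dotE !mxE !mulr0 addr0.
(* A point of the axis beyond [p] would put [p] strictly between it and the interior point [q]. *)
have axis y : K y -> Y y = 0 -> X y <= N.
  move=> Ky Yy; rewrite leNgt; apply/negP => XN; apply: nKp.
  have X0 : 0 < X y by exact: lt_trans XN.
  have pE : p = (1 - N / X y) *: q + (N / X y) *: y.
    have D : cross e f != 0.
      rewrite (_ : cross e f = N) ?gt_eqF// /cross f0 f1 /N dotE; ring.
    have Xn : X y != 0 by rewrite gt_eqF.
    apply: (dot_basis_eq _ _ _ _ D).
      rewrite -[LHS](subrK (dot e q)) -dotBr -/e -/N.
      rewrite -[RHS](subrK (dot e q)) -dotBr -/(X _) XD Xq mulr0 add0r.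
      by rewrite divfK.
    rewrite -[LHS](subrK (dot f q)) -dotBr -/e fe.
    by rewrite -[RHS](subrK (dot f q)) -dotBr -YE YD Yy Yq !mulr0 addr0.
  rewrite pE; apply: strictly_convex_mix sc _ _ _ => //.
  by rewrite divr_ge0 ?ltW//= ltr_pdivrMr// mul1r.
(* The segment from [u] to [v] crosses the axis, where [axis] applies. *)
have sep u v : K u -> K v -> 0 < Y u -> Y v < 0 ->
    (X v - N) / - Y v <= (N - X u) / Y u.
  move=> Ku Kv Yu Yv; pose t := Y u / (Y u - Y v).
  have d0 : 0 < Y u - Y v by rewrite subr_gt0 (lt_trans Yv).
  have dn : Y u - Y v != 0 by rewrite gt_eqF.
  have t01 : 0 <= t <= 1.
    apply/andP; split; first by apply: divr_ge0; exact: ltW.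
    by rewrite ler_pdivrMr// mul1r lerBrDr gerDl ltW.
  have := axis _ (strictly_convex_convex _ _ _ _ t sc Ku Kv t01).
  rewrite YD XD (_ : (1 - t) * Y u + t * Y v = 0); last by rewrite /t; field.
  move=> /(_ erefl) h.
  have {}h : (- Y v) * X u + Y u * X v <= N * (Y u - Y v).
    rewrite (_ : _ + _ = ((1 - t) * X u + t * X v) * (Y u - Y v)).
      by rewrite ler_pM2r.
    by rewrite /t; field.
  have Yv' : 0 < - Y v by rewrite oppr_gt0.
  rewrite ler_pdivrMr// mulrAC ler_pdivlMr//.
  move: h; generalize (X u) (X v) (Y u) (Y v) => a b c d; nra.
(* For [Y y < 0], the condition [X y + s * Y y <= N] says that [s] is at least this quotient. *)
pose E := [set (X y - N) / - Y y | y in [set y | K y /\ Y y < 0]].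
(* The interior point [q] can be moved to either side of the axis. This makes [E] nonempty here and
   bounded above further on, so that [sup E] is a genuine supremum. *)
have E0 : E !=set0.
  have [d d0 /(_ d)] := interior_ray _ _ (- f) Kq; rewrite lexx ltW// => /(_ erefl) Kd.
  exists ((X (q + d *: - f) - N) / - Y (q + d *: - f)).
  exists (q + d *: - f) => //; split; first exact: interior_subset.
  rewrite YE addrAC subrr add0r dotZr (_ : dot f (- f) = - dot f f); last first.
    by rewrite !dotE !mxE; ring.
  rewrite mulrN oppr_lt0 mulr_gt0// dot_gt0// => ff.
  move: N0; rewrite /N dotE -f1 -[e 0 1]opprK -f0 ff !mxE; lra.
have hE u : K u -> 0 < Y u -> ubound E ((N - X u) / Y u).
  by move=> Ku Yu _ [v [Kv Yv] <-]; exact: sep.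
exists (e + sup E *: f) => [h|y Ky].
  have := N0; rewrite (_ : N = dot e (e + sup E *: f)).
    by rewrite h dotE !mxE !mulr0 addr0 ltxx.
  by rewrite dotDr dotZr -/N !dotE f0 f1; ring.
suff h : X y + sup E * Y y <= N.
  rewrite -subr_ge0 -dotBr (_ : p - y = e - (y - q)); last first.
    by rewrite /e opprB addrA subrK.
  rewrite (_ : dot _ _ = N - (X y + sup E * Y y)) ?subr_ge0//.
  by rewrite dotDl dotZl !(dotBr _ e) fe YE -/(X y) -/N; ring.
have [Y0|Y0|Y0] := ltgtP (Y y) 0.
- have hsup : has_ubound E.
    have [d d0 /(_ d)] := interior_ray _ _ f Kq; rewrite lexx ltW// => /(_ erefl) Kd.
    exists ((N - X (q + d *: f)) / Y (q + d *: f)).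
    apply: hE; first exact: interior_subset.
    rewrite YE addrAC subrr add0r dotZr mulr_gt0// dot_gt0// => ff.
    by move: N0; rewrite /N dotE -f1 -[e 0 1]opprK -f0 ff !mxE; lra.
  have : (X y - N) / - Y y <= sup E by apply: ub_le_sup => //; exists y.
  rewrite ler_pdivrMr ?oppr_gt0//; lra.
- have : sup E <= (N - X y) / Y y by apply: ge_sup => //; exact: hE.
  by rewrite ler_pdivlMr//; lra.
- by rewrite Y0 mulr0 addr0 axis.
Qed.

(** Two supporting lines at one point differ exactly when their normals are independent. *)
Lemma singular_pointP K p : closed K -> singular_point K p <->
  [/\ K p, ~ interior K p & exists a b,
    [/\ cross a b != 0, supports K p a & supports K p b]].
Proof.
move=> cK; split.
- move=> [[+ niK] [L1 [L2 [[a [c [a0 -> ac Ka]]] [b [d [b0 -> bd Kb]]] neq]]]].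
  rewrite -(proj1 (closure_id K) cK) => Kp; split=> //.
  move: ac bd Ka Kb neq => /= <- <- Ka Kb neq; exists a, b; split=> //.
  apply/eqP => D; apply: neq.
  have [t bE] := cross_eq0 _ _ (elimN eqP a0) D.
  have t0 : t != 0 by apply: contraNneq b0 => t0; rewrite bE t0 scale0r.
  apply/seteqP; split=> y /=; rewrite bE !dotZl; first by move->.
  exact: mulfI.
- move=> [Kp niK [a [b [D Ka Kb]]]]; split.
    by split=> //; exact: subset_closure.
  have a0 := cross_neq0l _ _ D.
  have b0 : b <> 0 by move=> b0; move: D; rewrite b0 /cross !mxE !mulr0 subrr eqxx.
  exists [set y | dot a y = dot a p], [set y | dot b y = dot b p]; split.
  + by exists a, (dot a p); split=> //; exact/eqP.
  + by exists b, (dot b p); split=> //; exact/eqP.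
  (* [q] is a second point of the line with normal [a]; if the lines coincided, both normals would
     agree on [p] and [q], forcing [q = p]. *)
  + pose q : plane R := p + \row_k (if k == 0 then - a 0 1 else a 0 0).
    have qa : dot a q = dot a p by rewrite !dotE !mxE /=; ring.
    move=> h; have : [set y | dot b y = dot b p] q by rewrite -h.
    move=> /= /(dot_basis_eq _ _ _ _ D qa) /eqP.
    rewrite -subr_eq0 addrAC subrr add0r => /eqP qp; apply: a0.
    have := congr1 (fun u : plane R => u 0 0) qp.
    have := congr1 (fun u : plane R => u 0 1) qp; rewrite !mxE /= => h1 h0.
    by apply: plane_eq; rewrite mxE//; lra.
Qed.

End Support.

(** * Upper bounds for the number of junctions *)

Section Junctions.
Context {R : realType} (C : set (plane R)) (n : nat).
Variables (x : 'I_n -> plane R) (l : 'I_n -> R).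
Hypotheses (l_gt0 : forall i, 0 < l i)
  (scC : strictly_convex_with C (interior C)).
Let H i := homothet (x i) (l i) C.
Hypothesis incomparable : forall i j, i != j -> ~ (H i `<=` H j).

(** Relative to a set [S] of indices, so that an induction can discard homothets. *)
Definition junction_of (S : {set 'I_n}) (p : plane R) :=
  (forall i, i \in S -> H i p) /\
  exists i j, [/\ i \in S, j \in S, i != j, ~ interior (H i) p & ~ interior (H j) p].

Let scH i : strictly_convex_with (H i) (interior (H i)).
Proof. exact: homothet_strictly_convex. Qed.

Lemma junctions_on_largest (S : {set 'I_n}) j (s : seq (plane R)) : j \in S ->
  (forall i, i \in S -> l i <= l j) -> uniq s ->
  (forall p, p \in s -> junction_of S p /\ ~ interior (H j) p) ->
  (size s <= 2)%N.
Proof.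
move=> jS lmax us sJ; rewrite leqNgt; apply/negP => s3.
pose p (k : 'I_3) := nth 0 s k.
have ps k : p k \in s by rewrite mem_nth// (leq_trans _ s3).
have pI : injective p.
  by move=> k k' /eqP; rewrite nth_uniq ?(leq_trans (ltn_ord _) s3)// => /eqP/val_inj.
have other k : exists i, [/\ i \in S, i != j & ~ interior (H i) (p k)].
  have [[_ [i [i' [iS i'S ii' ni ni']]]] _] := sJ _ (ps k).
  have [ij|ij] := eqVneq i j; last by exists i.
  by exists i'; rewrite -ij eq_sym.
have [i iP] := choice other.
(* The map [z |-> mu k *: z + tau k] carries [H (i k)] onto [H j]. Its ratio is at least 1 since
   [l j] is largest, and incomparability keeps it from being the identity. *)
pose mu k := l j / l (i k); pose tau k := x j - mu k *: x (i k).
have lj := l_gt0 j; have ljn : l j != 0 by rewrite gt_eqF.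
have E k q : (l j)^-1 *: (mu k *: q + tau k - x j) = (l (i k))^-1 *: (q - x (i k)).
  have lin : l (i k) != 0 by rewrite gt_eqF.
  rewrite /tau addrA addrAC addrK -scalerBr scalerA /mu.
  by congr (_ *: _); field; rewrite ljn lin.
have HS k q : H (i k) q -> H j (mu k *: q + tau k).
  by move=> /(homothetP _ _ _ _ (l_gt0 _)) h; apply/homothetP; rewrite ?E.
apply: (no_three_contacts (H j) (interior (H j)) p mu tau (scH j) pI).
- by move=> k; have [[+ _] _] := sJ _ (ps k); apply.
- by move=> k; have [] := sJ _ (ps k).
- move=> k; have [iS _ _] := iP k.
  by rewrite /mu ler_pdivlMr// mul1r lmax.
- move=> k [muk tauk]; have [_ ij _] := iP k.
  apply: (incomparable _ _ ij) => q /HS.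
  by rewrite muk tauk scale1r addr0.
- move=> k m; have [iS _ _] := iP k; apply: HS.
  by have [[+ _] _] := sJ _ (ps m); apply.
- move=> k /(homothet_interiorP _ _ _ _ (l_gt0 j)); rewrite E.
  by have [_ _ + h] := iP k; apply; apply/homothet_interiorP.
Qed.

Let active j p : bool := `[< ~ interior (H j) p >].

(** Induction on [#|S|]: a largest homothet is active at no more than two junctions, and the other
    junctions survive its removal. A single homothet has no junction, whence the 2 on the left. *)
Lemma junctions_upper (S : {set 'I_n}) (s : seq (plane R)) : (0 < #|S|)%N -> uniq s ->
  (forall p, p \in s -> junction_of S p) -> (size s + 2 <= 2 * #|S|)%N.
Proof.
have [k] := ubnP #|S|; elim: k S s => // k IH S s; rewrite ltnS => Sk S0 us sJ.
have /card_gt0P[i0 i0S] := S0.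
have [j jS jmax] : exists2 j, j \in S & forall i, i \in S -> l i <= l j.
  by case: (@Order.TotalTheory.arg_maxP _ _ _ i0 (mem S) l i0S) => j; exists j.
pose s1 := [seq p <- s | active j p]; pose s2 := [seq p <- s | ~~ active j p].
have sE : size s = (size s1 + size s2)%N.
  by rewrite -[LHS](count_predC (active j)) !size_filter.
have s1le : (size s1 <= 2)%N.
  apply: (junctions_on_largest S j) => //; first exact: filter_uniq.
  by move=> p; rewrite mem_filter => /andP[/asboolP ? /sJ].
have cS : #|S| = #|S :\ j|.+1 by rewrite (cardsD1 j S) jS.
have s2J p : p \in s2 -> junction_of (S :\ j) p.
  rewrite mem_filter => /andP[/asboolPn/contrapT jp /sJ[Hp [a [b [aS bS ab na nb]]]]].
  split=> [i|]; first by rewrite !inE => /andP[_]; exact: Hp.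
  exists a, b; split=> //; rewrite !inE ?aS ?bS andbT.
    by apply: contra_notN na => /eqP ->.
  by apply: contra_notN nb => /eqP ->.
have [Sj0|Sj0] := posnP #|S :\ j|.
  have s0 : s = [::].
    case: (s) sJ => // p s' /(_ p (mem_head _ _))[_ [a [b [aS bS ab _ _]]]].
    have h c : c \in S -> c = j.
      move=> cS'; apply/eqP/negPn/negP => cj.
      by have := card0_eq Sj0 c; rewrite !inE cj cS'.
    by move: ab; rewrite (h _ aS) (h _ bS) eqxx.
  by rewrite s0 cS Sj0.
have lt_k : (#|S :\ j| < k)%N by rewrite -cS.
have h := IH (S :\ j) s2 lt_k Sj0 (filter_uniq _ us) s2J.
by rewrite cS mulnS sE -addnA leq_add.
Qed.

(** Count the pairs of a junction and a homothet active at it: every junction occurs at least twice,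
    and every homothet, being a largest one, at most twice. *)
Lemma junctions_upper_equal (S : {set 'I_n}) (s : seq (plane R)) :
  (forall i j, l i = l j) -> uniq s ->
  (forall p, p \in s -> junction_of S p) -> (size s <= #|S|)%N.
Proof.
move=> leq us sJ.
suff h : (size s * 2 <= #|S| * 2)%N by rewrite leq_mul2r in h.
have two p : p \in s -> (2 <= \sum_(j in S) (active j p : nat))%N.
  move=> /sJ[_ [a [b [aS bS ab na nb]]]].
  rewrite (bigD1 a)//= (bigD1 b)/=; last by rewrite bS eq_sym.
  by rewrite /active !asboolT.
apply: (@leq_trans (\sum_(p <- s) \sum_(j in S) (active j p : nat))%N).
  rewrite -(count_predT s) -sum1_count big_distrl /= big_seq [leqRHS]big_seq.
  by apply: leq_sum => p ps; rewrite mul1n two.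
rewrite exchange_big /= -sum_nat_const.
apply: leq_sum => j jS.
rewrite (_ : (\sum_(p <- s) _)%N = size [seq p <- s | active j p]); last first.
  by rewrite size_filter -sum1_count [RHS]big_mkcond; apply: eq_bigr => p _; case: active.
apply: (junctions_on_largest S j) => //; first by move=> i _; rewrite (leq i j).
  exact: filter_uniq.
by move=> p; rewrite mem_filter => /andP[/asboolP ? /sJ].
Qed.

End Junctions.

(** * Cardinalities through duplicate-free lists and injections *)

Section Cardinality.
Variables (T : choiceType) (A : set T) (k : nat).

(** An infinite set contains [k.+1] distinct points, so the bound on lists also yields
    finiteness. *)
Lemma card_le_seq : (forall s : seq T, uniq s -> (forall p, p \in s -> A p) ->
  (size s <= k)%N) -> A #<= `I_k.
Proof.
move=> h; have finA : finite_set A.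
  apply: contrapT => infA; have [B BA] := infinite_set_fset k.+1 infA.
  by rewrite ltnNge h// => p pB; exact: BA.
have [j Aj] := finA; rewrite (card_le_eql Aj) card_le_II -(card_fset_set Aj).
by apply: h => // p; rewrite in_fset_set// inE.
Qed.

Lemma seq_card_le (s : seq T) : A #<= `I_k -> uniq s ->
  (forall p, p \in s -> A p) -> (size s <= k)%N.
Proof.
move=> /pcard_leP[f] us sA.
have usf : uniq (map f s).
  rewrite map_inj_in_uniq// => p q /sA Ap /sA Aq.
  by apply: (@inj _ _ _ f); rewrite inE.
have fk : {subset map f s <= iota 0 k}.
  by move=> q /mapP[p /sA Ap ->]; rewrite mem_iota /= add0n; have := @funS _ _ _ _ f p Ap.
by have := uniq_leq_size usf fk; rewrite size_map size_iota.
Qed.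

Lemma card_ge_inj (e : 'I_k -> T) :
  injective e -> (forall i, A (e i)) -> `I_k #<= A.
Proof.
move=> eI Ae; apply: (@card_le_trans _ _ _ (range e)).
  have := @inj_card_eq _ _ [set: 'I_k] e (in2W eI).
  by rewrite (card_le_eql card_II) => /card_eqPle[].
by apply: subset_card_le => _ [i _ <-].
Qed.

End Cardinality.

(** * Vertices versus junctions *)

Section Vertices.
Context {R : realType} (C : set (plane R)) (n : nat).
Variables (x : 'I_n -> plane R) (l : 'I_n -> R).
Hypotheses (l_gt0 : forall i, 0 < l i) (closedC : closed C)
  (scC : strictly_convex_with C (interior C)).
Let H i := homothet (x i) (l i) C.
Hypothesis incomparable : forall i j, i != j -> ~ (H i `<=` H j).

Let junction := junction_of C n x l (finset xpredT).

Let scH i : strictly_convex_with (H i) (interior (H i)).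
Proof. exact: homothet_strictly_convex. Qed.

Lemma interior_bigcap_fin (F : 'I_n -> set (plane R)) p :
  (forall i, interior (F i) p) -> interior (\bigcap_i F i) p.
Proof.
move=> h; have := @filter_forall _ _ F (nbhs p) (nbhs_filter p) h.
by apply: filterS => q Fq i _; exact: Fq.
Qed.

Lemma supports_homothet (z p a : plane R) (r : R) : 0 < r ->
  supports (homothet z r C) p a <-> supports C (r^-1 *: (p - z)) a.
Proof.
move=> r0; have rn : r != 0 by rewrite gt_eqF.
split=> h y.
  move=> Cy; rewrite dotZr ler_pdivlMl// -dotZr.
  have := h (z + r *: y); rewrite dotDr dotBr lerBrDl; apply.
  by exists y.
move=> /(homothetP _ _ _ _ r0) /h.
by rewrite !dotZr ler_pM2l ?invr_gt0// !dotBr lerD2r.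
Qed.

(** A point [y] of [H i], pulled close enough to [p], enters every other [H k], and the inequality
    is unaffected by a contraction with centre [p]. *)
Lemma supports_active i p a : H i p ->
  (forall k, k != i -> interior (H k) p) ->
  supports (\bigcap_i H i) p a -> supports (H i) p a.
Proof.
move=> Hip ik sup y Hiy.
(* Replacing [H i] by the whole plane makes [p] interior to the intersection. *)
pose F k := if k == i then setT else H k.
have /(interior_ray _ _ (y - p))[e e0 he] : interior (\bigcap_k F k) p.
  apply: interior_bigcap_fin => k; rewrite /F; case: eqVneq => [_|/ik//].
  by rewrite interiorT.
pose t := Num.min e 1.
have t0 : 0 < t by rewrite lt_min e0 ltr01.
have t1 : t <= 1 by rewrite ge_min lexx orbT.
have te : t <= e by rewrite ge_min lexx.
have : (\bigcap_i H i) (p + t *: (y - p)).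
  move=> k _; have [->|ki] := eqVneq k i.
    rewrite (_ : _ + _ = (1 - t) *: p + t *: y).
      by apply: strictly_convex_convex (scH i) _ _ _ => //; rewrite ltW.
    by apply/rowP => j; rewrite !mxE; ring.
  have /interior_subset /(_ k I) : interior (\bigcap_k F k) (p + t *: (y - p)).
    by apply: he; rewrite te ltW.
  by rewrite /F (negbTE ki).
move=> /sup; rewrite dotDr dotZr gerDl pmulr_rle0// dotBr.
by rewrite subr_le0.
Qed.

Lemma closed_intersection : closed (\bigcap_i H i).
Proof. by apply: closed_bigI => i _; exact: homothet_closed. Qed.

(** A single homothet [H i] is active at [p], so outer normals of the intersection at [p] are outer
    normals of [H i], and these pull back to [C]. *)
Lemma lone_vertex p : Vert (\bigcap_i H i) p -> ~ junction p ->
  exists c, Vert C c /\ exists i, p = x i + l i *: c.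
Proof.
move=> /(singular_pointP _ _ closed_intersection)[Hp niH [a [b [D sa sb]]]] nJ.
have [i ni] : exists i, ~ interior (H i) p.
  apply: contrapT => h; apply: niH; apply: interior_bigcap_fin => i.
  by apply: contrapT => ni; apply: h; exists i.
have ik k : k != i -> interior (H k) p.
  move=> ki; apply: contrapT => nk; apply: nJ; split=> [j _|]; first exact: Hp.
  by exists k, i; split=> //; rewrite inE.
have {}sa := supports_active _ _ _ (Hp i I) ik sa.
have {}sb := supports_active _ _ _ (Hp i I) ik sb.
have lin : l i != 0 by rewrite gt_eqF.
exists ((l i)^-1 *: (p - x i)); split; last first.
  by exists i; rewrite scalerKV// addrC subrK.
apply/singular_pointP => //; split.
- by have /homothetP := Hp i I; apply.
- by move=> h; apply: ni; exact/homothet_interiorP.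
- by exists a, b; split=> //; exact/supports_homothet.
Qed.

(** The image of [c] in [H j] maximizes each of two independent normals over [H j]. Both images lie
    in all the homothets, so each normal takes the same value at both. *)
Lemma vertex_image_unique c i k : Vert C c ->
  (\bigcap_i H i) (x i + l i *: c) -> (\bigcap_i H i) (x k + l k *: c) ->
  x i + l i *: c = x k + l k *: c.
Proof.
move=> /(singular_pointP _ _ closedC)[_ _ [a [b [D sa sb]]]] Hi Hk.
have img j : (l j)^-1 *: (x j + l j *: c - x j) = c.
  by rewrite addrAC subrr add0r scalerK// gt_eqF.
have le d j j' : supports C c d -> (\bigcap_i H i) (x j' + l j' *: c) ->
    dot d (x j' + l j' *: c) <= dot d (x j + l j *: c).
  move=> sd /(_ j I); have : supports (H j) (x j + l j *: c) d.
    by apply/supports_homothet; rewrite ?img.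
  by apply.
by apply: (dot_basis_eq _ _ _ _ D); apply/eqP; rewrite eq_le !le.
Qed.

(** Vertices that are not junctions inject into [Vert C]. *)
Lemma vertices_upper k m :
  (forall s, uniq s -> (forall p, p \in s -> junction p) -> (size s <= k)%N) ->
  Vert C #<= `I_m -> Vert (\bigcap_i H i) #<= `I_(k + m).
Proof.
move=> Jk Cm; apply: card_le_seq => s us sV.
pose isJ p := `[< junction p >].
have -> : size s = (size [seq p <- s | isJ p] + size [seq p <- s | predC isJ p])%N.
  by rewrite !size_filter count_predC.
apply: leq_add.
  apply: Jk; first exact: filter_uniq.
  by move=> p; rewrite mem_filter => /andP[/asboolP].
(* Stated for every [p] so that [choice] applies; elsewhere the value 0 is a dummy. *)
have ex p : exists c, Vert (\bigcap_i H i) p -> ~ junction p ->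
    Vert C c /\ exists i, p = x i + l i *: c.
  have [[Vp nJ]|h] := pselect (Vert (\bigcap_i H i) p /\ ~ junction p).
    by have [c hc] := lone_vertex _ Vp nJ; exists c.
  by exists 0 => Vp nJ; exfalso; apply: h.
have [f fP] := choice ex.
have {}fP p : p \in [seq p <- s | predC isJ p] ->
    [/\ Vert (\bigcap_i H i) p, Vert C (f p) & exists i, p = x i + l i *: f p].
  by rewrite mem_filter => /andP[/asboolPn nJ /sV Vp]; have [] := fP p Vp nJ.
rewrite -(size_map f); apply: seq_card_le Cm _ _; last first.
  by move=> c /mapP[p /fP[_ + _] ->].
rewrite map_inj_in_uniq ?filter_uniq// => p q /fP[Vp Vfp [i pE]] /fP[Vq _ [j qE]] fpq.
have inH z : Vert (\bigcap_i H i) z -> (\bigcap_i H i) z.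
  by case/(singular_pointP _ _ closed_intersection).
rewrite pE qE -fpq; apply: vertex_image_unique => //.
  by rewrite -pE; exact: inH.
by rewrite fpq -qE; exact: inH.
Qed.

(** Two active homothets give normals [a] and [b]. If [b = t *: a], a negative [t] would confine the
    intersection to a line, and a positive one would make the homothets nested. *)
Lemma junction_is_vertex p : interior (\bigcap_i H i) !=set0 ->
  junction p -> Vert (\bigcap_i H i) p.
Proof.
move=> [z iHz] [Hp [i [j [_ _ ij ni nj]]]].
have HI : (\bigcap_i H i) p by move=> k _; apply: Hp; rewrite inE.
have iH k : interior (H k) `<=` H k by exact: interior_subset.
have iHk k : interior (\bigcap_i H i) `<=` interior (H k).
  by apply: interiorS => q; exact.
apply/(singular_pointP _ _ closed_intersection); split=> //.
  by move=> /(iHk i).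
have neH k : interior (H k) !=set0 by exists z; exact: iHk.
have [a a0 sa] := supports_exists _ _ (scH i) (neH i) (HI i I) ni.
have [b b0 sb] := supports_exists _ _ (scH j) (neH j) (HI j I) nj.
exists a, b; split; [|by move=> y /(_ i I)/sa|by move=> y /(_ j I)/sb].
apply/eqP => D; have [t bE] := cross_eq0 _ _ a0 D.
have [t0|t0|t0] := ltgtP t 0.
- have [y Hy] := interior_not_max _ _ _ b0 iHz.
  have [y' Hy'] := interior_not_max _ _ _ a0 iHz.
  have zH : (\bigcap_i H i) z by exact: interior_subset.
  have /sb := zH j I; rewrite bE !dotZl => h1.
  have /sa := Hy' i I => h2 h3.
  have h4 : dot a p <= dot a z by rewrite -(ler_nM2l t0).
  by move: h3; rewrite ltNge (le_trans h2 h4).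
- pose ci := (l i)^-1 *: (p - x i); pose cj := (l j)^-1 *: (p - x j).
  have sai : supports C ci a by exact/supports_homothet.
  have saj : supports C cj a.
    move=> y Cy; have : supports C cj b by exact/supports_homothet.
    by move=> /(_ y Cy); rewrite bE !dotZl ler_pM2l.
  have Ci : C ci by apply/homothetP => //; exact: HI.
  have Cj : C cj by apply/homothetP => //; exact: HI.
  (* Both points maximize [a] over [C]; if they differed, their midpoint would be an interior
     maximum. *)
  have [cE|/eqP cE] := eqVneq ci cj; last first.
    have h01 : (0 < 2^-1 :> R) && (2^-1 < 1 :> R).
      by rewrite invr_gt0 ltr0n invf_lt1 ?ltr0n// ltr1n.
    have [y Cy] := interior_not_max _ _ _ a0 (scC.2 _ _ _ Ci Cj cE h01).
    have eqc : dot a cj = dot a ci by apply/eqP; rewrite eq_le sai//= saj.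
    rewrite dotDr (dotZr a ci) (dotZr a cj) eqc -mulrDl subrK mul1r.
    by rewrite ltNge sai.
  (* A common preimage makes [p] a centre of homothety: the smaller set is a contraction of the
     larger one towards [p]. *)
  have nested u v : (l u)^-1 *: (p - x u) = (l v)^-1 *: (p - x v) ->
      l u <= l v -> C ((l v)^-1 *: (p - x v)) -> H u `<=` H v.
    move=> uv luv Cv y /(homothetP _ _ _ _ (l_gt0 u)) Cy; apply/homothetP => //.
    have lun : l u != 0 by rewrite gt_eqF.
    have lvn : l v != 0 by rewrite gt_eqF.
    rewrite (_ : _ *: _ = (1 - l u / l v) *: ((l v)^-1 *: (p - x v)) +
      (l u / l v) *: ((l u)^-1 *: (y - x u))).
      apply: strictly_convex_convex scC _ _ _ => //.
      apply/andP; split; first by apply: divr_ge0; exact: ltW.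
      by rewrite ler_pdivrMr// mul1r.
    have xuE : x u = p - l u *: ((l v)^-1 *: (p - x v)).
      by rewrite -uv scalerKV// opprB addrC subrK.
    rewrite xuE; apply/rowP => k; rewrite !mxE; field.
    by rewrite lun lvn.
  have [lij|/ltW lji] := leP (l i) (l j).
    by apply: (incomparable _ _ ij); exact: nested.
  by apply: (incomparable j i); [rewrite eq_sym|apply: nested].
- by apply: b0; rewrite bE t0 scale0r.
Qed.

End Vertices.

(** * First exits from disjoint open sets of reals *)

Section Exit.
Context {R : realType} (n : nat) (U : 'I_n -> set R).
Hypotheses (openU : forall i, open (U i))
  (disjU : forall i j t, U i t -> U j t -> i = j).

Let near i t : U i t -> exists2 e : R, 0 < e & forall u, `|u - t| < e -> U i u.
Proof.
move=> Ut; have /nbhs_ballP[e /= e0 he] : nbhs t (U i) by exact: open_nbhs_nbhs.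
by exists e => // u ut; apply: he; rewrite /ball /= distrC.
Qed.

(** [e] is the supremum of the times up to which [U i] persists. No other [U k] contains it, since
    an open set around [e] would reach back into [U i]. *)
Lemma first_exit i s b : U i s -> s < b -> ~ U i b ->
  exists e, [/\ s < e, forall t, s <= t < e -> U i t & forall k, ~ U k e].
Proof.
move=> Us sb nUb.
pose E : set R := [set t | s <= t <= b /\ forall u, s <= u <= t -> U i u].
have Es : E s.
  split; first by rewrite lexx ltW.
  by move=> u us; rewrite (_ : u = s)//; apply/eqP; rewrite eq_sym eq_le.
have ubE : has_ubound E by exists b => t [/andP[]].
have supE : has_sup E by split=> //; exists s.
pose e := sup E; have leE t : E t -> t <= e by move=> Et; apply: ub_le_sup.
have eb : e <= b by apply: ge_sup; [exists s|move=> t [/andP[]]].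
have se' : s <= e by exact: leE.
have Ue t : s <= t < e -> U i t.
  move=> /andP[st te]; have et0 : 0 < e - t by rewrite subr_gt0.
  have [u [_ h]] := sup_adherent et0 supE; rewrite subKr => tu.
  by apply: h; rewrite st ltW.
have nUe : ~ U i e.
  move=> Uie; have [d d0 hd] := near _ _ Uie.
  have eb' : e < b.
    by rewrite lt_neqAle eb andbT; apply/eqP => ebE; rewrite ebE in Uie.
  pose t := Num.min b (e + d / 2).
  have et : e < t by rewrite lt_min eb' ltrDl divr_gt0.
  suff /leE : E t by rewrite leNgt et.
  split; first by rewrite (le_trans se' (ltW et)) ge_min lexx.
  move=> u /andP[su ut]; have [ue|eu] := ltP u e; first by apply: Ue; rewrite su.
  have {}ut : u <= e + d / 2 by apply: le_trans ut _; rewrite ge_min lexx orbT.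
  by apply: hd; rewrite ger0_norm ?subr_ge0//; lra.
have se : s < e.
  by rewrite lt_neqAle se' andbT; apply/eqP => seE; apply: nUe; rewrite -seE.
exists e; split=> // k Uk; have [d d0 hd] := near _ _ Uk.
pose t := Num.max s (e - d / 2).
have te : t < e by rewrite gt_max se ltrBlDr ltrDl divr_gt0.
have st : s <= t by rewrite le_max lexx.
have et : e - d / 2 <= t by rewrite le_max lexx orbT.
have Uit : U i t by apply: Ue; rewrite st.
have Ukt : U k t by apply: hd; rewrite distrC ger0_norm ?subr_ge0 ?ltW//; lra.
by apply: nUe; rewrite (disjU _ _ _ Uit Ukt).
Qed.

(** Just before a common exit, two of the disjoint sets would share a time. *)
Lemma first_exits_injective (s b : 'I_n -> R) : (forall i, U i (s i)) ->
  (forall i, s i < b i) -> (forall i, ~ U i (b i)) ->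
  exists2 e : 'I_n -> R, injective e & forall i k, ~ U k (e i).
Proof.
move=> Us sb nUb.
have [e eP] := choice (fun i => first_exit i _ _ (Us i) (sb i) (nUb i)).
exists e => [i j eij|i k]; last by have [_ _] := eP i; apply.
have [si hi _] := eP i; have [sj hj _] := eP j.
apply: (disjU _ _ (Num.max (s i) (s j))).
  by apply: hi; rewrite le_max lexx /= gt_max si eij.
by apply: hj; rewrite le_max lexx orbT /= gt_max sj -eij si.
Qed.

End Exit.

(* Inverse stereographic projection, up to a positive factor: as t runs over
   the reals, the direction runs over the circle without the direction v. *)
Section Stereographic.
Context {R : realType} (v f : plane R).
Hypothesis vf : cross v f != 0.

Definition stereo (t : R) : plane R := (t ^+ 2 - 1) *: v + (2 * t) *: f.

Lemma basis_inj (a b a' b' : R) :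
  a *: v + b *: f = a' *: v + b' *: f -> a = a' /\ b = b'.
Proof.
have E (u w : plane R) (r t : R) : cross (r *: u + t *: w) w = r * cross u w.
  by rewrite /cross !mxE; ring.
have E' (u w : plane R) (r t : R) : cross u (r *: u + t *: w) = t * cross u w.
  by rewrite /cross !mxE; ring.
move=> h; split; apply: (mulIf vf); first by rewrite -(E _ _ _ b) h E.
by rewrite -(E' _ _ a) h E'.
Qed.

Lemma stereo_neq0 t : stereo t <> 0.
Proof.
rewrite /stereo => h.
have [] : t ^+ 2 - 1 = 0 /\ 2 * t = 0.
  by apply: basis_inj; rewrite h !scale0r addr0.
move=> {h} h /eqP; rewrite mulf_eq0 pnatr_eq0 /= => /eqP t0.
by move: h; rewrite t0 expr0n /=; lra.
Qed.

Lemma stereo_inj (r r' t t' : R) : 0 < r -> 0 < r' ->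
  r *: stereo t = r' *: stereo t' -> t = t'.
Proof.
move=> r0 r'0; rewrite /stereo !scalerDr !scalerA => /basis_inj[h1 h2].
(* Lengths are compared through the identity of [(t ^+ 2 - 1) ^+ 2 + (2 * t) ^+ 2] with
   [(t ^+ 2 + 1) ^+ 2]. *)
have h3 : (r * (t ^+ 2 + 1)) ^+ 2 = (r' * (t' ^+ 2 + 1)) ^+ 2.
  rewrite (_ : (r * _) ^+ 2 = (r * (t ^+ 2 - 1)) ^+ 2 + (r * (2 * t)) ^+ 2).
    by rewrite h1 h2; ring.
  by ring.
have pos (q u : R) : 0 < q -> 0 <= q * (u ^+ 2 + 1).
  move=> q0; apply: mulr_ge0; first exact: ltW.
  by apply: addr_ge0 => //; exact: sqr_ge0.
have {h3}/eqP := h3; rewrite eqrXn2 ?pos// => /eqP h3.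
have rr' : r = r' by lra.
by apply: (mulfI (lt0r_neq0 r0)); move: h2; rewrite rr'; lra.
Qed.

Lemma stereo_onto (p : plane R) : (forall a, 0 <= a -> p <> a *: v) ->
  exists r t, 0 < r /\ p = r *: stereo t.
Proof.
move=> np; have [a [b pE]] := cross_basis _ _ p vf.
pose q := Num.sqrt (a ^+ 2 + b ^+ 2).
have q0 : 0 <= q by exact: sqrtr_ge0.
have q2 : q ^+ 2 = a ^+ 2 + b ^+ 2 by rewrite sqr_sqrtr// addr_ge0// sqr_ge0.
have N0 : 0 < q - a.
  rewrite subr_gt0 ltNge; apply/negP => qa.
  have a0 : 0 <= a by exact: le_trans qa.
  have q2a : q ^+ 2 <= a ^+ 2 by rewrite ler_sqr.
  have /eqP : b ^+ 2 = 0 by apply/eqP; rewrite eq_le sqr_ge0 andbT; lra.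
  rewrite sqrf_eq0 => /eqP b0; apply: (np a a0).
  by rewrite pE b0 scale0r addr0.
have Nn : q - a != 0 by rewrite gt_eqF.
(* Half-angle substitution: [q] is the length of the coordinate vector [(a, b)], and
   [b ^+ 2 = (q - a) * (q + a)]. *)
exists ((q - a) / 2), (b / (q - a)); split; first by rewrite divr_gt0.
rewrite pE /stereo scalerDr !scalerA; congr (_ *: _ + _ *: _); last by field.
have b2 : b ^+ 2 = (q - a) * (q + a) by rewrite -subr_sqr q2; ring.
by rewrite expr_div_n b2; field.
Qed.

Lemma stereo_continuous (z : plane R) (r : R) :
  continuous (fun t => z + r *: stereo t).
Proof.
move=> t; apply: cvgD; first exact: cvg_cst.
apply: cvgZ; first exact: cvg_cst.
apply: cvgD; apply: cvgZr_tmp; last by apply: cvgM; [exact: cvg_cst|exact: cvg_id].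
by apply: cvgB; [apply: cvgM; exact: cvg_id|exact: cvg_cst].
Qed.

(** With [u = t^-1] and [r = u ^+ 2] the vector becomes [(1 - u ^+ 2) *: v + (2 * u) *: f], which
    tends to [v]: both ends of the real line approach the omitted direction. *)
Lemma stereo_infinity (W : set (plane R)) (z : plane R) : open W -> W (z + v) ->
  exists2 M : R, 0 < M & forall t, M <= `|t| ->
    exists r, 0 < r /\ W (z + r *: stereo t).
Proof.
move=> oW Wv.
have h : (fun u : R => z + ((1 - u ^+ 2) *: v + (2 * u) *: f)) @ (0 : R) -->
    z + ((1 - 0 ^+ 2) *: v + (2 * 0) *: f).
  apply: cvgD; first exact: cvg_cst.
  apply: cvgD; apply: cvgZr_tmp; last by apply: cvgM; [exact: cvg_cst|exact: cvg_id].
  by apply: cvgB; [exact: cvg_cst|apply: cvgM; exact: cvg_id].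
rewrite expr0n /= subr0 mulr0 scale1r scale0r addr0 in h.
have /h/nbhs_ballP[d /= d0 hd] : nbhs (z + v) W by exact: open_nbhs_nbhs.
exists (2 / d); first by rewrite divr_gt0.
move=> t tM; have t0 : 0 < `|t| by apply: lt_le_trans tM; rewrite divr_gt0.
have tn : t != 0 by rewrite -normr_gt0.
exists (t ^- 2); split; first by rewrite invr_gt0 exprn_even_gt0.
have := hd t^-1; rewrite /ball /= sub0r normrN normfV.
have td : `|t|^-1 < d.
  rewrite invf_plt ?posrE//; apply: lt_le_trans tM.
  by rewrite -[X in X < _]mul1r ltr_pM2r ?invr_gt0// ltr1n.
move=> /(_ td); congr (W (_ + _)).
by rewrite /stereo scalerDr !scalerA; congr (_ *: _ + _ *: _); field.
Qed.

End Stereographic.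

(** * Rays from an interior point, and the lower bound for junctions *)

Section Rays.
Context {R : realType} (n : nat) (F : 'I_n -> set (plane R)) (z : plane R).
Hypotheses (closedF : forall i, closed (F i))
  (scF : forall i, strictly_convex_with (F i) (interior (F i)))
  (zF : interior (\bigcap_i F i) z)
  (boundedF : exists M : R, forall p, (\bigcap_i F i) p -> `|p| <= M).

(** On the ray from [z] through [q], the set [F i] is the only one left by the time [q] is
    reached. *)
Definition only_beyond i (q : plane R) :=
  (forall k, k != i -> interior (F k) q) /\ ~ F i q.

Let interior_center i : interior (F i) z.
Proof. by apply: interiorS zF => q; exact. Qed.

(** Reducedness gives a point outside [F i] and in all the others; a small move towards [z] makes it
    interior to these while it stays outside the closed [F i]. *)
Lemma only_beyond_exists i : reduced_intersection F -> exists q, only_beyond i q.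
Proof.
move=> /(_ i)[_ /nonsubset [w [wF nw]]].
have nFi : ~ F i w.
  move=> Fiw; apply: nw => k _; have [->//|ki] := eqVneq k i; exact: wF.
have : interior (~` F i) w.
  by apply: open_nbhs_nbhs; split=> //; exact: closed_openC.
move=> /(interior_ray _ _ (z - w))[e e0 he].
pose t := Num.min e 1; have t0 : 0 < t by rewrite lt_min e0 ltr01.
have t1 : t <= 1 by rewrite ge_min lexx orbT.
exists (w + t *: (z - w)); split; last first.
  apply: (@interior_subset _ (~` F i)); apply: he.
  by rewrite ltW// ge_min lexx.
move=> k ki; rewrite (_ : _ + _ = (1 - (1 - t)) *: z + (1 - t) *: w).
  by apply: strictly_convex_mix (scF k) _ _ _ => //; [exact: wF|lra].
by apply/rowP => j; rewrite !mxE; ring.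
Qed.

(** The farther point lies in [F i], so by convexity the nearer one does too. *)
Lemma only_beyond_lt d i k (r r' : R) : i != k -> 0 < r -> r <= r' ->
  only_beyond i (z + r *: d) -> only_beyond k (z + r' *: d) -> False.
Proof.
move=> ik r0 rr' [_ nFi] [/(_ i ik) /interior_subset Fi _]; apply: nFi.
have r'n : r' != 0 by rewrite gt_eqF// (lt_le_trans r0).
rewrite (_ : _ + _ = (1 - r / r') *: z + (r / r') *: (z + r' *: d)).
  apply: strictly_convex_convex (scF i) _ _ _ => //.
    exact: interior_subset.
  have r'0 : 0 < r' by exact: lt_le_trans rr'.
  by apply/andP; split; [apply: divr_ge0; exact: ltW|rewrite ler_pdivrMr// mul1r].
by apply/rowP => j; rewrite !mxE; field.
Qed.

Lemma only_beyond_disjoint d i k (r r' : R) : 0 < r -> 0 < r' ->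
  only_beyond i (z + r *: d) -> only_beyond k (z + r' *: d) -> i = k.
Proof.
move=> r0 r'0 hi hk; apply/eqP/negPn/negP => ik.
have [rr'|/ltW r'r] := leP r r'; first exact: only_beyond_lt ik r0 rr' hi hk.
by apply: only_beyond_lt _ r'0 r'r hk hi; rewrite eq_sym.
Qed.

Lemma only_beyond_open i : open (only_beyond i).
Proof.
rewrite (_ : only_beyond i =
  interior (\bigcap_k (if k == i then setT else F k)) `&` ~` F i).
  by apply: openI; [exact: open_interior|exact: closed_openC].
apply/seteqP; split=> q [Fq nFq]; split=> //.
  apply: interior_bigcap_fin => k; case: eqVneq => [_|/Fq//].
  by rewrite interiorT.
move=> k ki; have := @interiorS _ _ (F k) _ q Fq; apply => y /(_ k I).
by rewrite (negbTE ki).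
Qed.

(** Take the last point of the ray in the intersection. If two sets are active there, it is a
    junction; if only [F i] is, slightly farther points have left [F i] alone. *)
Lemma ray_dichotomy (d : plane R) : d <> 0 ->
  (exists i r, 0 < r /\ only_beyond i (z + r *: d)) \/
  exists r, [/\ 0 < r, forall i, F i (z + r *: d) &
    exists i j, [/\ i != j, ~ interior (F i) (z + r *: d)
      & ~ interior (F j) (z + r *: d)]].
Proof.
move=> /eqP d0; have nd0 : 0 < `|d| by rewrite normr_gt0.
pose E : set R := [set r | 0 <= r /\ (\bigcap_i F i) (z + r *: d)].
have E0 : E 0.
  by split=> //; rewrite scale0r addr0; exact: interior_subset.
have ubE : has_ubound E.
  have [M hM] := boundedF; exists ((M + `|z|) / `|d|) => r [r0 /hM h].
  rewrite ler_pdivlMr// -[X in X * _]ger0_norm// -normrZ.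
  rewrite (_ : r *: d = (z + r *: d) - z); last by rewrite addrAC subrr add0r.
  by rewrite (le_trans (ler_normB _ _))// lerD2r.
have supE : has_sup E by split=> //; exists 0.
pose s := sup E; have leE r : E r -> r <= s by move=> Er; apply: ub_le_sup.
have s0 : 0 < s.
  have [e e0 /(_ e)] := interior_ray _ _ d zF; rewrite lexx ltW// => /(_ isT) h.
  have Ee : E e by split; [exact: (ltW e0)|exact: (interior_subset h)].
  exact: (lt_le_trans e0 (leE _ Ee)).
have Fs : (\bigcap_i F i) (z + s *: d).
  move=> i _; apply: contrapT => nFi.
  have : interior (~` F i) (z + s *: d).
    by apply: open_nbhs_nbhs; split=> //; exact: closed_openC.
  move=> /(interior_ray _ _ (- d))[e e0 he].
  have [r Er rs] := sup_adherent e0 supE.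
  have rs' : 0 <= s - r <= e by rewrite subr_ge0 leE//= lerBlDl -lerBlDr ltW.
  have /interior_subset := he _ rs'; apply.
  rewrite (_ : _ + _ = z + r *: d); first by have [_] := Er; apply.
  by apply/rowP => j; rewrite !mxE; ring.
have beyond e : 0 < e -> ~ (\bigcap_i F i) (z + s *: d + e *: d).
  move=> e0; rewrite -addrA -scalerDl => h.
  have : s + e <= s by apply: leE; split=> //; rewrite addr_ge0// ltW.
  by rewrite gerDl leNgt e0.
have [i ni] : exists i, ~ interior (F i) (z + s *: d).
  apply: contrapT => h.
  have : interior (\bigcap_i F i) (z + s *: d).
    apply: interior_bigcap_fin => i.
    by apply: contrapT => ni; apply: h; exists i.
  move=> /(interior_ray _ _ d)[e e0 /(_ e)]; rewrite lexx ltW// => /(_ isT).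
  by move=> /interior_subset; exact: beyond.
have [[k [ki nk]]|h] := pselect (exists k, k != i /\ ~ interior (F k) (z + s *: d)).
  by right; exists s; split=> // [j|]; [exact: Fs|exists k, i].
left; pose G k := if k == i then setT else F k.
have : interior (\bigcap_k G k) (z + s *: d).
  apply: interior_bigcap_fin => k; rewrite /G; case: eqVneq => [_|ki].
    by rewrite interiorT.
  by apply: contrapT => nk; apply: h; exists k.
move=> /(interior_ray _ _ d)[e e0 /(_ e)]; rewrite lexx ltW// => /(_ isT) Ge.
have Fe k : k != i -> interior (F k) (z + s *: d + e *: d).
  move=> ki; have := @interiorS _ _ (F k) _ _ Ge; apply => y /(_ k I).
  by rewrite /G (negbTE ki).
exists i, (s + e); split; first by rewrite addr_gt0.
rewrite scalerDl addrA; split=> // Fi; apply: (beyond e e0) => k _.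
by have [->//|/Fe/interior_subset] := eqVneq k i.
Qed.

Lemma junctions_lower : (2 <= n)%N -> reduced_intersection F ->
  exists e : 'I_n -> plane R, injective e /\
    forall i, (forall k, F k (e i)) /\ exists a b,
      [/\ a != b, ~ interior (F a) (e i) & ~ interior (F b) (e i)].
Proof.
move=> n2 red; have [w wP] := choice (fun i => only_beyond_exists i red).
(* The circle of directions is cut at a direction [v] belonging to [i0]; the second index [j0]
   guarantees an exit from [U i0]. *)
pose i0 : 'I_n := Ordinal (ltnW n2); pose j0 : 'I_n := Ordinal n2.
have w_neq i : w i <> z.
  by have [_ nF] := wP i; move=> wz; apply: nF; rewrite wz; exact: interior_subset.
pose v := w i0 - z.
have v0 : v <> 0 by move=> /eqP; rewrite subr_eq0 => /eqP; exact: w_neq.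
pose f : plane R := \row_k (if k == 0 then - v 0 1 else v 0 0).
have vf : cross v f != 0.
  rewrite (_ : cross v f = dot v v) ?gt_eqF ?dot_gt0//.
  by rewrite /cross dotE [f 0 0]mxE [f 0 1]mxE /=; ring.
have zv : z + v = w i0 by rewrite addrC subrK.
pose U i := [set t | exists r, 0 < r /\ only_beyond i (z + r *: stereo v f t)].
have openU i : open (U i).
  rewrite openE => t [r [r0 Wt]].
  have : nbhs (z + r *: stereo v f t) (only_beyond i).
    by apply: open_nbhs_nbhs; split=> //; exact: only_beyond_open.
  move=> /(stereo_continuous v f z r t) h.
  by apply: (@filterS _ (nbhs t) _ _ (U i) _ h) => u Wu; exists r.
have disjU i j t : U i t -> U j t -> i = j.
  by move=> [r [r0 hi]] [r' [r'0 hj]]; exact: only_beyond_disjoint r0 r'0 hi hj.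
have neU i : exists t, i != i0 -> U i t.
  have [->|ii0] := eqVneq i i0; first by exists 0.
  have [a a0 wE|r [t [r0 E]]] := stereo_onto v f vf (w i - z).
    have {}wE : w i = z + a *: v by rewrite -wE addrC subrK.
    move: a0; rewrite le_eqVlt => /predU1P[a0|a0].
      by apply: (w_neq i); rewrite wE -a0 scale0r addr0.
    move/eqP: ii0; apply; apply: (@only_beyond_disjoint v i i0 a 1) => //.
      by rewrite -wE.
    by rewrite scale1r zv.
  by exists t => _; exists r; split=> //; rewrite -E addrC subrK.
have [s sU] := choice neU.
have [M M0 hM] := stereo_infinity v f (only_beyond i0) z (only_beyond_open i0)
  (eq_ind_r (only_beyond i0) (wP i0) zv).
(* Both [B] and [- B] fall in [U i0], and every [s i] lies strictly between them. *)
pose B := M + \sum_i `|s i|.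
have sB i : `|s i| < B.
  rewrite /B (bigD1 i)//= addrCA ltrDl ltr_wpDr// sumr_ge0// => j _.
have BM : M <= B by rewrite lerDl sumr_ge0.
have B0 : 0 <= B by rewrite (le_trans (ltW M0)).
have [e eI nUe] : exists2 e : 'I_n -> R, injective e & forall i k, ~ U k (e i).
  (* [U i0] is followed from [- B], just past the cut, and is left by the time [s j0]; every other
     [U i] is left by the time [B]. *)
  apply: (first_exits_injective _ _ openU disjU
    (fun i => if i == i0 then - B else s i)
    (fun i => if i == i0 then s j0 else B)) => i; case: eqVneq => ii0; rewrite ?ii0.
  - by apply: hM; rewrite normrN ger0_norm.
  - exact: sU.
  - by have := sB j0; rewrite ltr_norml => /andP[].
  - by have := sB i; rewrite ltr_norml => /andP[].
  - by move=> Us; have := disjU _ _ _ Us (sU j0 isT).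
  - move=> UB; move/eqP: ii0; apply; apply: disjU UB _.
    by apply: hM; rewrite ger0_norm.
have ex i : exists r, [/\ 0 < r, forall k, F k (z + r *: stereo v f (e i)) &
    exists a b, [/\ a != b, ~ interior (F a) (z + r *: stereo v f (e i))
      & ~ interior (F b) (z + r *: stereo v f (e i))]].
  have [[k [r [r0 Wk]]]|//] := ray_dichotomy _ (stereo_neq0 v f vf (e i)).
  by exfalso; apply: (nUe i k); exists r.
have [r rP] := choice ex.
exists (fun i => z + r i *: stereo v f (e i)); split=> [i j /addrI|i].
  by have [ri _ _] := rP i; have [rj _ _] := rP j => /(stereo_inj v f vf _ _ _ _ ri rj)/eI.
by have [_ Fi Ji] := rP i.
Qed.

End Rays.

(** Translates are the case of equal ratios, where the bound on junctions improves from
    [2 * (n - 1)] to [n]. *)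
Lemma polygon_vertices (R : realType) (C : set (plane R)) (m n : nat)
    (x : 'I_n -> plane R) (l : 'I_n -> R) :
  strictly_convex_domain C -> Vert C #= `I_m -> (2 <= n)%N ->
  (forall i, 0 < l i) ->
  let H := fun i => homothet (x i) (l i) C in
  proper_intersection H ->
  [/\ `I_n #<= Vert (\bigcap_i H i), Vert (\bigcap_i H i) #<= `I_(2 * (n - 1) + m)
    & (forall i j, l i = l j) -> Vert (\bigcap_i H i) #<= `I_(n + m)].
Proof.
move=> /strictly_convex_domainW[cC clC iC scC] /card_eqPle[Cm _] n2 l0 H [red iH].
(* An inclusion of [H i] in [H j] would make [H j] redundant, against reducedness. *)
have incomparable i j : i != j -> ~ (H i `<=` H j).
  move=> ij Hij; have [_ /nonsubset [z [zH nz]]] := red j.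
  apply: nz => k _; have [->|kj] := eqVneq k j; last exact: zH.
  by apply: Hij; exact: zH.
pose S : {set 'I_n} := finset xpredT.
have cS : #|S| = n by rewrite cardsE card_ord.
split.
- have [z zH] := iH; have i0 : 'I_n := Ordinal (ltnW n2).
  have bdH : exists M : R, forall p, (\bigcap_i H i) p -> `|p| <= M.
    (* One bounded homothet bounds the intersection; [hM] covers only numbers strictly above [M],
       hence [M + 1]. *)
    have [M [_ hM]] := compact_bounded cC; exists (`|x i0| + l i0 * (M + 1)).
    move=> _ /(_ i0 I)[y Cy <-]; apply: le_trans (ler_normD _ _) _.
    rewrite lerD2l normrZ gtr0_norm// ler_pM2l//.
    by apply: hM => //; rewrite ltrDl.
  have [e [eI eP]] := junctions_lower n H z (fun i => homothet_closed _ _ _ (l0 i) clC)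
    (fun i => homothet_strictly_convex _ _ _ (l0 i) scC) zH bdH n2 red.
  apply: card_ge_inj eI _ => i; apply: junction_is_vertex => //.
  have [Fi [a [b [ab na nb]]]] := eP i; split=> [k _|]; first exact: Fi.
  by exists a, b; split=> //; rewrite inE.
- apply: vertices_upper Cm => // s us sJ.
  have := junctions_upper C n x l l0 scC incomparable S s _ us sJ.
  by rewrite cS (ltnW n2) => /(_ isT); rewrite mulnBr muln1 leq_subRL 1?addnC//; lia.
- move=> leq; apply: vertices_upper Cm => // s us sJ; rewrite -cS.
  exact: junctions_upper_equal us sJ.
Qed.

Theorem theorem1 (R : realType) (C : set (plane R)) (m n : nat)
    (x : 'I_n -> plane R) (lambda : 'I_n -> R)
    (hC : strictly_convex_domain C)
    (hm : Vert C #= `I_m)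
    (hn : (2 <= n)%N)
    (hlambda : forall i, 0 < lambda i) :
  let T := fun i => translate (x i) C in
  let H := fun i => homothet (x i) (lambda i) C in
  (proper_intersection T ->
     `I_n #<= Vert (\bigcap_i T i) /\
     Vert (\bigcap_i T i) #<= `I_(n + m)) /\
  (proper_intersection H ->
     `I_n #<= Vert (\bigcap_i H i) /\
     Vert (\bigcap_i H i) #<= `I_(2 * (n - 1) + m)).
Proof.
move=> T H; split=> [|/(polygon_vertices R C m n x lambda hC hm hn hlambda)[]//].
rewrite (_ : T = fun i => homothet (x i) ((fun=> 1) i) C); last first.
  by apply/funext => i; exact: translateE.
move=> /(polygon_vertices R C m n x (fun=> 1) hC hm hn (fun=> ltr01)).
by move=> [? _ /(_ (fun _ _ => erefl))].
Qed.
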